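(* Let $S$ be an inverse semigroup, let $(X,S,p)$ be a supported action, and let $Y=(X,E(S),p)$ be the presheaf over $E(S)$ obtained by restricting the action of $S$ on $X$ to the idempotents of $S$. Then there is an idempotent-separating homomorphism (representation) $\xi\colon S\to T_Y$ into the generalised Munn semigroup $T_Y$ of $Y$, whose image is a wide inverse subsemigroup of $T_Y$.
   Context: For an inverse semigroup $S$, $E(S)$ is its semilattice of idempotents. An inverse subsemigroup is wide if it contains all idempotents. A homomorphism is idempotent-separating if it is injective on idempotents. ''Semilattice'' means meet-semilattice, i.e. a commutative semigroup of idempotents, with $e\le f\iff e=ef$; $e^{\downarrow}=\{f: f\le e\}$. A supported (right) action $(X,S,p)$ of an inverse semigroup $S$ on a set $X$ consists of maps $X\times S\to X$, $(x,s)\mapsto x\cdot s$, and $p\colon X\to E(S)$ such that for all $x\in X$, $s,t\in S$: (SA1) $(x\cdot s)\cdot t=x\cdot st$; (SA2) $x\cdot p(x)=x$; (SA3) $p(x\cdot s)=s^{-1}p(x)s$. A presheaf $(X,E,p)$ over a semilattice $E$ is a supported action of $E$. The partial order on $X$ is $x\le y\iff x=y\cdot p(x)$. For a presheaf $(X,E,p)$ and $e\in E$, the principal subpresheaf at $e$ is $(X\cdot e,e^{\downarrow},p_e)$ with $X\cdot e=\{x\cdot e:x\in X\}=\{x\in X:p(x)\le e\}$ and $p_e=p|_{X\cdot e}$. An isomorphism from the principal subpresheaf at $e$ to that at $f$ is a pair $(\alpha,\theta)$ of order-isomorphisms $\alpha\colon X\cdot e\to X\cdot f$, $\theta\colon e^{\downarrow}\to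 f^{\downarrow}$ with $p(\alpha(x))=\theta(p(x))$ for all $x\in X\cdot e$. The generalised Munn semigroup $T_X$ of $(X,E,p)$ is the set of all such isomorphisms between principal subpresheaves of $X$, with product $(\alpha,\theta)(\beta,\phi)=(\alpha\beta,\theta\phi)$, componentwise composition of partial bijections (right factor applied first, on the largest possible domain); it is an inverse semigroup. *)

(* Defs.v *)
From HB Require Import structures.
From mathcomp Require Import all_boot.
From mathcomp Require Import boolp classical_sets.

Set Implicit Arguments.
Unset Strict Implicit.
Unset Printing Implicit Defensive.

Local Open Scope group_scope.

(* MathComp's own [_^-1] requires a unit, hence the separate operation. *)
HB.mixin Record Semigroup_isInverse S of Semigroup S := {
  sinv : S -> S;
  mulsVs : forall s : S, s * sinv s * s = s;
  mulVsV : forall s : S, sinv s * s * sinv s = sinv s;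
  sinv_uniq : forall s t : S, s * t * s = s -> t * s * t = t -> t = sinv s
}.

#[short(type="invSemigroupType")]
HB.structure Definition InvSemigroup := {S of Semigroup_isInverse S & Semigroup S}.

HB.mixin Record Semigroup_isSemilattice E of Semigroup E := {
  mulsC : commutative (@mul E);
  mulss : forall e : E, e * e = e
}.

(* A semilattice carries its unique inverse operation, so that it can act. *)
#[short(type="semilatticeType")]
HB.structure Definition Semilattice :=
  {E of Semigroup_isSemilattice E & InvSemigroup E}.

Section InvSemigroupTheory.
Variable S : invSemigroupType.
Implicit Types s t e f : S.

Lemma sinv_idem e : e * e = e -> sinv e = e.
Proof. by move=> ee; apply/esym/sinv_uniq; rewrite !ee. Qed.

Lemma mul_idem e f : e * e = e -> f * f = f -> (e * f) * (e * f) = e * f.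
Proof.
move=> ee ff; set x := sinv (e * f).
have h1 : e * f * x * (e * f) = e * f := mulsVs (e * f).
have h2 : x * (e * f) * x = x := mulVsV (e * f).
have hx : f * x * e = x.
  apply: sinv_uniq; last first.
    transitivity (f * (x * ((e * e) * (f * f)) * x) * e).
      by rewrite !mulgA.
    by rewrite ee ff h2.
  transitivity (e * (f * f) * x * (e * e) * f); first by rewrite !mulgA.
  by rewrite ee ff -[RHS]h1 !mulgA.
have xx : x * x = x.
  rewrite -{1 2}hx.
  transitivity (f * (x * (e * f) * x) * e); first by rewrite !mulgA.
  by rewrite h2.
have : e * f = sinv x by apply: sinv_uniq.
by rewrite sinv_idem // => ->.
Qed.

Lemma idem_comm e f : e * e = e -> f * f = f -> e * f = f * e.
Proof.
move=> ee ff; have h1 := mul_idem ee ff; have h2 := mul_idem ff ee.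
rewrite -[LHS](sinv_idem h1); apply/esym/sinv_uniq.
  transitivity (e * (f * f) * (e * e) * f); first by rewrite !mulgA.
  by rewrite ee ff -[RHS]h1 !mulgA.
transitivity (f * (e * e) * (f * f) * e); first by rewrite !mulgA.
by rewrite ee ff -[RHS]h2 !mulgA.
Qed.
End InvSemigroupTheory.

Record idempotents (S : semigroupType) :=
  Idem { idem_val : S; _ : idem_val * idem_val == idem_val }.

HB.instance Definition _ (S : semigroupType) :=
  [isSub for @idem_val S].
HB.instance Definition _ (S : semigroupType) :=
  [Choice of idempotents S by <:].

Lemma idemP (S : semigroupType) (e : idempotents S) : val e * val e = val e.
Proof. exact/eqP/(valP e). Qed.

Section IdempotentSemilattice.
Variable S : invSemigroupType.
Implicit Types e f g : idempotents S.

Definition idem_mul e f : idempotents S :=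
  Idem (introT eqP (mul_idem (idemP e) (idemP f))).

Fact idem_mulA : associative idem_mul.
Proof. by move=> e f g; apply: val_inj; rewrite /= mulgA. Qed.

HB.instance Definition _ := isSemigroup.Build (idempotents S) idem_mulA.

Fact idem_mulC : commutative (@mul (idempotents S)).
Proof. by move=> e f; apply: val_inj; apply: idem_comm; apply: idemP. Qed.

Fact idem_mulee e : e * e = e.
Proof. exact/val_inj/idemP. Qed.

Fact idem_inv_uniq e f : e * f * e = e -> f * e * f = f -> f = e.
Proof.
have aux (a b : idempotents S) : a * b * a = a -> a = a * b.
  by move=> {1}<-; rewrite -mulgA [b * a]idem_mulC mulgA idem_mulee.
by move=> /aux he /aux hf; rewrite hf [f * e]idem_mulC -he.
Qed.

HB.instance Definition _ := Semigroup_isInverse.Build (idempotents S)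
  (fun e => etrans (congr1 (mul^~ e) (idem_mulee e)) (idem_mulee e))
  (fun e => etrans (congr1 (mul^~ e) (idem_mulee e)) (idem_mulee e))
  idem_inv_uniq.

HB.instance Definition _ :=
  Semigroup_isSemilattice.Build (idempotents S) idem_mulC idem_mulee.
End IdempotentSemilattice.

Record supportedAction (X : Type) (S : invSemigroupType) := SupportedAction {
  act : X -> S -> X;
  supp : X -> idempotents S;
  actM : forall x s t, act (act x s) t = act x (s * t);
  act_supp : forall x, act x (val (supp x)) = x;
  supp_act : forall x s, val (supp (act x s)) = sinv s * val (supp x) * s
}.

Definition presheaf (X : Type) (E : semilatticeType) := supportedAction X E.

Section Restriction.
Variables (X : Type) (S : invSemigroupType) (A : supportedAction X S).

Let ract x (e : idempotents S) := act A x (val e).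
(* E(E(S)) is a copy of E(S). *)
Let rsupp x : idempotents (idempotents S) :=
  Idem (introT eqP (idem_mulee (supp A x))).

Fact ractM x e f : ract (ract x e) f = ract x (e * f).
Proof. exact: actM. Qed.

Fact ract_supp x : ract x (val (rsupp x)) = x.
Proof. exact: act_supp. Qed.

Fact rsupp_act x e : val (rsupp (ract x e)) = sinv e * val (rsupp x) * e.
Proof.
by apply: val_inj; rewrite /= supp_act sinv_idem //; apply: idemP.
Qed.

Definition restrict_idem : presheaf X (idempotents S) :=
  SupportedAction ractM ract_supp rsupp_act.
End Restriction.

Definition sl_le (E : semilatticeType) (e f : E) : Prop := e = e * f.
Definition down (E : semilatticeType) (e : E) : set E :=
  [set f | sl_le f e]%classic.

Section SemilatticeOrder.
Variable E : semilatticeType.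
Implicit Types e f g : E.

Lemma sl_le_refl e : sl_le e e. Proof. by rewrite /sl_le mulss. Qed.

Lemma sl_le_trans f e g : sl_le e f -> sl_le f g -> sl_le e g.
Proof. by rewrite /sl_le => ef fg; rewrite {2}ef -mulgA -fg. Qed.

Lemma sl_le_meet e f g : sl_le g (e * f) <-> sl_le g e /\ sl_le g f.
Proof.
rewrite /sl_le; split=> [h|[he hf]]; last by rewrite mulgA -he.
split; last by rewrite {2}h -!mulgA mulss.
by rewrite {2}h -!mulgA (mulsC f) (mulgA e e) mulss.
Qed.
End SemilatticeOrder.

Section PresheafOrder.
Variables (X : Type) (E : semilatticeType) (P : presheaf X E).

Definition presheaf_le (x y : X) : Prop := x = act P y (val (supp P x)).
Definition principal (e : E) : set X := [set act P x e | x in [set: X]]%classic.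

Lemma principalE e x : principal e x <-> down e (val (supp P x)).
Proof.
rewrite /principal /down /= /sl_le; split=> [[y _ <-]|h].
  by rewrite supp_act -!mulgA mulss.
by exists x => //; rewrite -{1}(act_supp P x) actM -h act_supp.
Qed.
End PresheafOrder.

(* A partial map T -> option T, with domain exactly A and range exactly B,
   that is an order-isomorphism from A onto B. *)
Record order_iso (T : Type) (le : T -> T -> Prop) (A B : set T)
    (f : T -> option T) : Prop := OrderIso {
  oiso_dom : forall x, A x <-> f x;
  oiso_ran : forall y, B y <-> exists x, f x = Some y;
  oiso_inj : forall x x' y, f x = Some y -> f x' = Some y -> x = x';
  oiso_le : forall x x' y y', f x = Some y -> f x' = Some y' ->
    (le x x' <-> le y y')
}.

Record presheaf_iso (X : Type) (E : semilatticeType) (P : presheaf X E)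
    (e f : E) (alpha : X -> option X) (theta : E -> option E) : Prop :=
  PresheafIso {
  piso_alpha : order_iso (presheaf_le P) (principal P e) (principal P f) alpha;
  piso_theta : order_iso (@sl_le E) (down e) (down f) theta;
  piso_supp : forall x, principal P e x ->
    omap (fun y => val (supp P y)) (alpha x) = theta (val (supp P x))
}.

Record munn (X : Type) (E : semilatticeType) (P : presheaf X E) := Munn {
  munn_alpha : X -> option X;
  munn_theta : E -> option E;
  munnP : exists e f, presheaf_iso P e f munn_alpha munn_theta
}.

Definition pinv (T : Type) (f : T -> option T) (y : T) : option T :=
  if pselect (exists x, f x = Some y) is left ex then Some (projT1 (cid ex))
  else None.

Section PartialMaps.
Variable T : Type.
Implicit Types f g h : T -> option T.

Definition pinjective f := forall x x' y, f x = Some y -> f x' = Some y -> x = x'.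

Lemma pinvE f : pinjective f -> forall x y, pinv f y = Some x <-> f x = Some y.
Proof.
move=> fI x y; rewrite /pinv; case: pselect => [ex|nex]; last first.
  by split=> // h; case: nex; exists x.
case: (cid ex) => x' /= h; split=> [[<-] //|h'].
by congr Some; apply: fI h h'.
Qed.

Lemma pext f g : (forall x y, f x = Some y <-> g x = Some y) -> f = g.
Proof.
move=> h; apply/funext => x; case E: (f x) => [y|]; first by rewrite (h x y).1.
by case E': (g x) => [y|//]; rewrite -E (h x y).2.
Qed.

Lemma pcompE f g x y :
  pcomp f g x = Some y <-> exists2 z, g x = Some z & f z = Some y.
Proof.
rewrite /pcomp; case: (g x) => [z|] /=; split=> //.
- by exists z.
- by case=> _ [<-].
- by case.
Qed.

Lemma pcompA f g h : pcomp f (pcomp g h) = pcomp (pcomp f g) h.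
Proof. by apply/funext => x; rewrite /pcomp; case: (h x). Qed.

Lemma pinj_pinv f : pinjective f -> pinjective (pinv f).
Proof. by move=> fI x x' y; rewrite !pinvE // => -> []. Qed.

Lemma pcompVK f : pinjective f -> pcomp (pcomp f (pinv f)) f = f.
Proof.
move=> fI; apply: pext => x y; rewrite pcompE; split=> [[z xz]|xy].
  by move/pcompE => [t /(pinvE fI) tz ty]; rewrite (fI _ _ _ xz tz).
by exists y => //; apply/pcompE; exists x => //; apply/pinvE.
Qed.

Lemma pinvK f : pinjective f -> pinv (pinv f) = f.
Proof.
move=> fI; apply: pext => x y.
by rewrite pinvE; [rewrite pinvE | apply: pinj_pinv].
Qed.

Lemma pinv_uniq f g : pinjective f -> pinjective g ->
  pcomp (pcomp f g) f = f -> pcomp (pcomp g f) g = g -> g = pinv f.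
Proof.
have aux (u v : T -> option T) : pinjective u -> pcomp (pcomp u v) u = u ->
    forall x y, u x = Some y -> v y = Some x.
  move=> uI uvu x y xy; have := xy; rewrite -{1}uvu => /pcompE[y'].
  rewrite xy => -[<-] /pcompE[z yz zy]; by rewrite (uI _ _ _ xy zy).
move=> fI gI h1 h2; apply: pext => y x; rewrite pinvE //.
by split; apply: aux.
Qed.

Lemma order_iso_pinv (le : T -> T -> Prop) A B f :
  order_iso le A B f -> order_iso le B A (pinv f).
Proof.
move=> [fd fr fI fle]; split.
- move=> y; rewrite fr; split=> [[x /(pinvE fI) ->] //|].
  by case E: (pinv f y) => [x|//] _; exists x; apply/pinvE.
- move=> x; rewrite fd; split.
    by case E: (f x) => [y|//] _; exists y; apply/pinvE.
  by case=> y /(pinvE fI) ->.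
- exact: pinj_pinv.
- by move=> y y' x x' /(pinvE fI) h /(pinvE fI) h'; rewrite (fle _ _ _ _ h h').
Qed.
End PartialMaps.

Section GeneralisedMunn.
Variables (X : Type) (E : semilatticeType) (P : presheaf X E).
Implicit Types a b c : munn P.
Local Notation p x := (val (supp P x)).

Lemma munn_eq a b :
  munn_alpha a = munn_alpha b -> munn_theta a = munn_theta b -> a = b.
Proof.
case: a b => [a t H] [a' t' H'] /= aa tt; subst a' t'.
by rewrite (Prop_irrelevance H H').
Qed.

Lemma piso_some e f (al : X -> option X) th x y :
  presheaf_iso P e f al th -> al x = Some y -> th (p x) = Some (p y).
Proof.
move=> [ha _ hs] xy; rewrite -hs ?xy //.
by apply/(oiso_dom ha); rewrite xy.
Qed.

Lemma presheaf_iso_pinv e f al th : presheaf_iso P e f al th ->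
  presheaf_iso P f e (pinv al) (pinv th).
Proof.
move=> H; have [ha ht _] := H.
have aI := oiso_inj ha; have tI := oiso_inj ht.
split; [exact: order_iso_pinv | exact: order_iso_pinv | move=> y].
move/(oiso_ran ha) => [x xy].
have -> : pinv al y = Some x by apply/pinvE.
by symmetry; apply/(pinvE tI); apply: piso_some H xy.
Qed.

Lemma presheaf_iso_comp e f e' f' al th be ph :
  presheaf_iso P e f al th -> presheaf_iso P e' f' be ph ->
  exists g h, presheaf_iso P g h (pcomp al be) (pcomp th ph).
Proof.
move=> H H'; have [ha ht _] := H; have [hb hp _] := H'.
pose m := f' * e.
have mf : sl_le m f' by case: ((sl_le_meet f' e m).1 (sl_le_refl m)).
have me : sl_le m e by case: ((sl_le_meet f' e m).1 (sl_le_refl m)).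
have [g gm] := (oiso_ran hp m).1 mf.
have [h mh] : exists h, th m = Some h.
  by have := (oiso_dom ht m).1 me; case: (th m) => // h _; exists h.
have ge : sl_le g e' by apply/(oiso_dom hp); rewrite gm.
have hf : sl_le h f by apply/(oiso_ran ht); exists m.
exists g, h; split.
- split.
  + move=> x; rewrite principalE /down /=; split=> [xg|].
      have: principal P e' x by apply/principalE; apply: sl_le_trans ge.
      move=> /(oiso_dom hb); rewrite /pcomp; case xy: (be x) => [y|] //= _.
      have ym := (oiso_le hp (piso_some H' xy) gm).1 xg.
      apply/(oiso_dom ha)/principalE; exact: sl_le_trans me.
    rewrite /pcomp; case xy: (be x) => [y|] //= /(oiso_dom ha)/principalE ye.
    apply/(oiso_le hp (piso_some H' xy) gm)/sl_le_meet; split=> //.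
    by apply/principalE/(oiso_ran hb); exists x.
  + move=> z; rewrite principalE /down /=; split=> [zh|].
      have /(oiso_ran ha)[y yz] : principal P f z.
        by apply/principalE; apply: sl_le_trans hf.
      have ym := (oiso_le ht (piso_some H yz) mh).2 zh.
      have /(oiso_ran hb)[x xy] : principal P f' y.
        by apply/principalE; apply: sl_le_trans mf.
      by exists x; apply/pcompE; exists y.
    case=> x /pcompE[y xy yz].
    apply/(oiso_le ht (piso_some H yz) mh)/sl_le_meet; split.
      by apply/principalE/(oiso_ran hb); exists x.
    by apply/principalE/(oiso_dom ha); rewrite yz.
  + move=> x x' z /pcompE[y xy yz] /pcompE[y' xy' yz'].
    rewrite -(oiso_inj ha yz yz') in xy'; exact: oiso_inj hb _ _ _ xy xy'.
  + move=> x x' z z' /pcompE[y xy yz] /pcompE[y' xy' yz'].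
    by rewrite (oiso_le hb xy xy') (oiso_le ha yz yz').
- split.
  + move=> x; rewrite /down /=; split=> [xg|].
      have /(oiso_dom hp) : down e' x by apply: sl_le_trans ge.
      rewrite /pcomp; case xy: (ph x) => [y|] //= _.
      have ym := (oiso_le hp xy gm).1 xg.
      apply/(oiso_dom ht); exact: sl_le_trans me.
    rewrite /pcomp; case xy: (ph x) => [y|] //= /(oiso_dom ht) ye.
    apply/(oiso_le hp xy gm)/sl_le_meet; split=> //.
    by apply/(oiso_ran hp); exists x.
  + move=> z; rewrite /down /=; split=> [zh|].
      have /(oiso_ran ht)[y yz] : down f z by apply: sl_le_trans hf.
      have ym := (oiso_le ht yz mh).2 zh.
      have /(oiso_ran hp)[x xy] : down f' y by apply: sl_le_trans mf.
      by exists x; apply/pcompE; exists y.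
    case=> x /pcompE[y xy yz].
    apply/(oiso_le ht yz mh)/sl_le_meet; split.
      by apply/(oiso_ran hp); exists x.
    by apply/(oiso_dom ht); rewrite yz.
  + move=> x x' z /pcompE[y xy yz] /pcompE[y' xy' yz'].
    rewrite -(oiso_inj ht yz yz') in xy'; exact: oiso_inj hp _ _ _ xy xy'.
  + move=> x x' z z' /pcompE[y xy yz] /pcompE[y' xy' yz'].
    by rewrite (oiso_le hp xy xy') (oiso_le ht yz yz').
- move=> x /principalE xg.
  have /(oiso_dom hb) : principal P e' x.
    by apply/principalE; apply: sl_le_trans ge.
  case xy: (be x) => [y|] //= _.
  have py := piso_some H' xy.
  have ym := (oiso_le hp py gm).1 xg.
  have /(oiso_dom ha) : principal P e y.
    by apply/principalE; apply: sl_le_trans me.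
  case yz: (al y) => [z|] //= _.
  by rewrite /pcomp xy py /= yz (piso_some H yz).
Qed.

Fact munn_mulP a b : exists e f, presheaf_iso P e f
  (pcomp (munn_alpha a) (munn_alpha b)) (pcomp (munn_theta a) (munn_theta b)).
Proof.
case: a b => [al th [e [f H]]] [be ph [e' [f' H']]].
exact: presheaf_iso_comp H H'.
Qed.

Fact munn_invP a : exists e f, presheaf_iso P e f
  (pinv (munn_alpha a)) (pinv (munn_theta a)).
Proof.
case: a => [al th [e [f H]]]; exists f, e; exact: presheaf_iso_pinv.
Qed.

(* [pcomp u v] applies v first, and is defined wherever both steps are. *)
Definition munn_mul a b : munn P := Munn (munn_mulP a b).
Definition munn_inv a : munn P := Munn (munn_invP a).

Fact munn_mulA : associative munn_mul.
Proof. by move=> a b c; apply: munn_eq; rewrite /= pcompA. Qed.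

HB.instance Definition _ := gen_eqMixin (munn P).
HB.instance Definition _ := gen_choiceMixin (munn P).
HB.instance Definition _ := isSemigroup.Build (munn P) munn_mulA.

Lemma munn_alpha_inj a : pinjective (munn_alpha a).
Proof. by have [e [f [ha _ _]]] := munnP a; apply: oiso_inj ha. Qed.

Lemma munn_theta_inj a : pinjective (munn_theta a).
Proof. by have [e [f [_ ht _]]] := munnP a; apply: oiso_inj ht. Qed.

Fact munn_mulaVa a : a * munn_inv a * a = a.
Proof.
apply: munn_eq; rewrite /= pcompVK //;
  [exact: munn_alpha_inj | exact: munn_theta_inj].
Qed.

Fact munn_mulVaV a : munn_inv a * a * munn_inv a = munn_inv a.
Proof.
have -> : munn_inv a * a = munn_inv a * munn_inv (munn_inv a).
  by congr (_ * _); apply: munn_eq; rewrite /= pinvK //;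
    [exact: munn_alpha_inj | exact: munn_theta_inj].
exact: munn_mulaVa.
Qed.

Fact munn_inv_uniq a b : a * b * a = a -> b * a * b = b -> b = munn_inv a.
Proof.
move=> h1 h2; apply: munn_eq; apply: pinv_uniq.
- exact: munn_alpha_inj.
- exact: munn_alpha_inj.
- by have := congr1 (@munn_alpha X E P) h1.
- by have := congr1 (@munn_alpha X E P) h2.
- exact: munn_theta_inj.
- exact: munn_theta_inj.
- by have := congr1 (@munn_theta X E P) h1.
- by have := congr1 (@munn_theta X E P) h2.
Qed.

HB.instance Definition _ := Semigroup_isInverse.Build (munn P)
  munn_mulaVa munn_mulVaV munn_inv_uniq.
End GeneralisedMunn.

Definition inverse_subsemigroup (T : invSemigroupType) (A : set T) : Prop :=
  (forall s t, A s -> A t -> A (s * t)) /\ (forall s, A s -> A (sinv s)).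

Definition wide (T : invSemigroupType) (A : set T) : Prop :=
  forall e : T, e * e = e -> A e.

Definition idempotent_separating (S T : semigroupType) (phi : S -> T) : Prop :=
  forall e f : S, e * e = e -> f * f = f -> phi e = phi f -> e = f.

(* Main.v *)
Require Import Defs.
From HB Require Import structures.
From mathcomp Require Import all_boot.
From mathcomp Require Import boolp classical_sets.

Set Implicit Arguments.
Unset Strict Implicit.
Unset Printing Implicit Defensive.

Local Open Scope group_scope.

(** Products in the Munn semigroup apply the right factor first whereas [S]
    acts on the right, so [s] is sent to the pair [x |-> x s^-1],
    [e |-> s e s^-1], restricted to the elements below [s^-1 s].  The second
    component of the image of an idempotent [e] is the identity of the ideal
    below [e], from which [e] can be recovered.  Conversely an idempotent
    partial injection is the identity on its domain, so every idempotent of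
    the Munn semigroup is the identity of a principal subpresheaf, that is, the
    image of an idempotent of [S]. *)

(** * Restrictions of total maps, viewed as partial maps *)

Section PartialRestriction.
Variable T : Type.
Implicit Types (D : set T) (g : T -> T).

Definition prestrict D g (x : T) : option T :=
  if `[< D x >] then Some (g x) else None.

Lemma prestrictE D g x y : prestrict D g x = Some y <-> D x /\ g x = y.
Proof.
rewrite /prestrict; case: asboolP => Dx; first by split=> [[]|[_ ->]].
by split=> [|[]].
Qed.

Lemma prestrict_dom D g x : D x <-> prestrict D g x.
Proof. by rewrite /prestrict; case: asboolP. Qed.

Lemma eq_prestrict D g g' :
  (forall x, D x -> g x = g' x) -> prestrict D g = prestrict D g'.
Proof.
by move=> gg'; apply/funext => x; rewrite /prestrict; case: asboolP => // /gg' ->.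
Qed.

Lemma pcomp_prestrict D1 D2 D g1 g2 g :
  (forall x, D x <-> D2 x /\ D1 (g2 x)) -> (forall x, g x = g1 (g2 x)) ->
  pcomp (prestrict D1 g1) (prestrict D2 g2) = prestrict D g.
Proof.
move=> hD hg; apply: pext => x y; rewrite pcompE prestrictE hD hg; split.
  by case=> z /prestrictE[D2x <-] /prestrictE[D1x <-].
by case=> [[D2x D1x] <-]; exists (g2 x); apply/prestrictE.
Qed.

(** Monotonicity of [g'] makes [g] reflect the order. It is asked on all of [T] because both the
    action and conjugation are monotone everywhere; only the inverse laws need the domains. *)
Lemma order_iso_prestrict (le : T -> T -> Prop) D D' g g' :
  (forall x, D x -> D' (g x)) -> (forall y, D' y -> D (g' y)) ->
  (forall x, D x -> g' (g x) = x) -> (forall y, D' y -> g (g' y) = y) ->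
  (forall x y, le x y -> le (g x) (g y)) ->
  (forall x y, le x y -> le (g' x) (g' y)) ->
  order_iso le D D' (prestrict D g).
Proof.
move=> DD' D'D gK g'K gle g'le; split.
- exact: prestrict_dom.
- move=> y; split=> [D'y|[x /prestrictE[Dx <-]]]; last exact: DD'.
  by exists (g' y); apply/prestrictE; split; [apply: D'D | apply: g'K].
- by move=> x x' y /prestrictE[Dx <-] /prestrictE[Dx' /(congr1 g')]; rewrite !gK.
- move=> x x' _ _ /prestrictE[Dx <-] /prestrictE[Dx' <-]; split; first exact: gle.
  by move=> /g'le; rewrite !gK.
Qed.

(** If [f] sends [x] to [z], idempotency makes it send [z] to [z] as well, so injectivity gives
    [x = z]. *)
Lemma idem_pinjective (f : T -> option T) D :
  pinjective f -> pcomp f f = f -> (forall x, D x <-> f x) ->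
  f = prestrict D id.
Proof.
move=> fI ff fD; apply: pext => x y; rewrite prestrictE fD.
suff fix_ z : f x = Some z -> x = z.
  split=> [xy|[]]; first by split; [rewrite xy | apply: fix_].
  by case E: (f x) => [z|] //= _ <-; rewrite -(fix_ _ E).
move=> xz; have := xz; rewrite -{1}ff => /pcompE[t xt tz].
have zt : t = z by apply: Some_inj; rewrite -xt -xz.
by apply: fI xz _; rewrite -{1}zt.
Qed.
End PartialRestriction.

(** * Conjugation of idempotents by elements of an inverse semigroup *)

Section Conjugation.
Variable S : invSemigroupType.
Implicit Types (s t : S) (e f : idempotents S).

Lemma sinvK s : sinv (sinv s) = s.
Proof. by apply/esym/sinv_uniq; rewrite ?mulVsV ?mulsVs. Qed.

Lemma idem_sVs s : (sinv s * s) * (sinv s * s) = sinv s * s.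
Proof. by rewrite mulgA mulVsV. Qed.

Lemma idem_ssV s : (s * sinv s) * (s * sinv s) = s * sinv s.
Proof. by rewrite mulgA mulsVs. Qed.

(** Since the idempotents [t t^-1] and [s^-1 s] commute, [t^-1 s^-1] satisfies both equations that
    characterise the inverse of [s t]. *)
Lemma sinvM s t : sinv (s * t) = sinv t * sinv s.
Proof.
have C := idem_comm (idem_ssV t) (idem_sVs s).
apply/esym/sinv_uniq.
  transitivity (s * ((t * sinv t) * (sinv s * s)) * t); first by rewrite !mulgA.
  rewrite C; transitivity ((s * sinv s * s) * (t * sinv t * t)).
    by rewrite !mulgA.
  by rewrite !mulsVs.
transitivity (sinv t * ((sinv s * s) * (t * sinv t)) * sinv s).
  by rewrite !mulgA.
rewrite -C; transitivity ((sinv t * t * sinv t) * (sinv s * s * sinv s)).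
  by rewrite !mulgA.
by rewrite !mulVsV.
Qed.

(** Expand [s] as [s s^-1 s] and move the idempotent [s^-1 s] past [e]. *)
Lemma conj_mul s e f :
  s * val (e * f) * sinv s = s * val e * sinv s * (s * val f * sinv s).
Proof.
transitivity (s * ((sinv s * s) * val e) * val f * sinv s).
  by rewrite !mulgA mulsVs.
by rewrite (idem_comm (idem_sVs s) (idemP e)) !mulgA.
Qed.

Fact idem_conj_subproof s e :
  s * val e * sinv s * (s * val e * sinv s) == s * val e * sinv s.
Proof. by rewrite -conj_mul mulss. Qed.

Definition idem_conj s e : idempotents S := Idem (idem_conj_subproof s e).

Definition idem_dom s : idempotents S := Idem (introT eqP (idem_sVs s)).

Lemma idem_conjM s t e : idem_conj (s * t) e = idem_conj s (idem_conj t e).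
Proof. by apply: val_inj; rewrite /= sinvM !mulgA. Qed.

Lemma idem_conj_val e f : idem_conj (val f) e = e * f.
Proof.
apply: val_inj; rewrite /= sinv_idem ?idemP //.
by rewrite (idem_comm (idemP f) (idemP e)) -mulgA idemP.
Qed.

Lemma idem_conjK s e : idem_conj (sinv s) (idem_conj s e) = e * idem_dom s.
Proof. by rewrite -idem_conjM -idem_conj_val. Qed.

Lemma idem_conjVK s e :
  idem_conj s (idem_conj (sinv s) e) = e * idem_dom (sinv s).
Proof. by rewrite -idem_conjK sinvK. Qed.

Lemma idem_conj_le s e f :
  sl_le e f -> sl_le (idem_conj s e) (idem_conj s f).
Proof.
by rewrite /sl_le => ef; apply: val_inj; rewrite {1}ef /= -conj_mul.
Qed.

Lemma idem_conj_le_dom s e : sl_le (idem_conj s e) (idem_dom (sinv s)).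
Proof.
by apply: val_inj; rewrite /= sinvK -!mulgA (mulgA (sinv s)) mulVsV.
Qed.

Lemma idem_domM s t : idem_dom (s * t) = idem_conj (sinv t) (idem_dom s).
Proof. by apply: val_inj; rewrite /= sinvM sinvK !mulgA. Qed.

Lemma idem_dom_val e : idem_dom (val e) = e.
Proof. by apply: val_inj; rewrite /= sinv_idem idemP. Qed.

(** This matches the domain of a composite of partial maps. It holds because conjugations by [t] and
    [t^-1] are monotone and undo each other below [t^-1 t] and [t t^-1]. *)
Lemma le_idem_domM s t e : sl_le e (idem_dom (s * t)) <->
  sl_le e (idem_dom t) /\ sl_le (idem_conj t e) (idem_dom s).
Proof.
rewrite idem_domM; split=> [h|[et h]].
  split.
    by rewrite -[t in idem_dom t]sinvK; apply: sl_le_trans h (idem_conj_le_dom _ _).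
  have := idem_conj_le t h; rewrite idem_conjVK => /sl_le_meet[]; done.
by have := idem_conj_le (sinv t) h; rewrite idem_conjK -et.
Qed.
End Conjugation.

(** * The representation and its properties *)

Section MunnRepresentation.
Variables (S : invSemigroupType) (X : Type) (A : supportedAction X S).
Local Notation P := (restrict_idem A).
Implicit Types (s t : S) (e f : idempotents S) (x y : X).

Lemma principal_restrictE e x : principal P e x <-> sl_le (supp A x) e.
Proof. exact: principalE. Qed.

Lemma supp_actV x s : supp A (act A x (sinv s)) = idem_conj s (supp A x).
Proof. by apply: val_inj; rewrite supp_act sinvK. Qed.

(** Commuting [s s^-1] with [p(x)] gives [s (s^-1 p(x) s) = p(x) s], and [y p(x) = x]. *)
Lemma act_le s x y :
  presheaf_le P x y -> presheaf_le P (act A x s) (act A y s).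
Proof.
rewrite /presheaf_le /= => xy.
rewrite actM supp_act !mulgA (idem_comm (idem_ssV s) (idemP _)) -!mulgA.
by rewrite (mulgA s) mulsVs -actM; congr act.
Qed.

Lemma act_le_supp e x : sl_le (supp A x) e -> act A x (val e) = x.
Proof.
by move=> /(congr1 val) /= xe; rewrite -{1}(act_supp A x) actM -xe act_supp.
Qed.

Lemma actVK s x : sl_le (supp A x) (idem_dom s) ->
  act A (act A x (sinv s)) s = x.
Proof. by move=> /act_le_supp; rewrite actM. Qed.

Definition munn_rep_alpha s : X -> option X :=
  prestrict (principal P (idem_dom s)) (fun x => act A x (sinv s)).

Definition munn_rep_theta s : idempotents S -> option (idempotents S) :=
  prestrict (Defs.down (idem_dom s)) (idem_conj s).

Fact munn_rep_subproof s :
  exists e f, presheaf_iso P e f (munn_rep_alpha s) (munn_rep_theta s).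
Proof.
exists (idem_dom s), (idem_dom (sinv s)); split.
- apply: (order_iso_prestrict (g' := fun x => act A x s)).
  + move=> x _; rewrite principal_restrictE supp_actV.
    exact: idem_conj_le_dom.
  (* Reading [s] as the inverse of [s^-1] turns this into the previous case. *)
  + move=> x _; rewrite principal_restrictE -[s in act A x s]sinvK supp_actV.
    by rewrite -[s in idem_dom s]sinvK; apply: idem_conj_le_dom.
  + by move=> x /principal_restrictE/actVK.
  + by move=> x /principal_restrictE/actVK; rewrite sinvK.
  + by move=> x y; apply: act_le.
  + by move=> x y; apply: act_le.
- apply: (order_iso_prestrict (g' := idem_conj (sinv s))).
  + by move=> e _; apply: idem_conj_le_dom.
  + by move=> e _; rewrite -[s in idem_dom s]sinvK; apply: idem_conj_le_dom.
  + by move=> e es; rewrite idem_conjK -es.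
  + by move=> e es; rewrite idem_conjVK -es.
  + by move=> e f; apply: idem_conj_le.
  + by move=> e f; apply: idem_conj_le.
- move=> x xs.
  have -> : munn_rep_alpha s x = Some (act A x (sinv s)).
    exact/prestrictE.
  apply/esym/prestrictE; split; first exact/principal_restrictE.
  by rewrite /= supp_actV.
Qed.

Definition munn_rep s : munn P := Munn (munn_rep_subproof s).

Fact munn_repM s t : munn_rep (s * t) = munn_rep s * munn_rep t.
Proof.
apply: munn_eq; apply/esym/pcomp_prestrict.
- move=> x; rewrite !principal_restrictE supp_actV; exact: le_idem_domM.
- by move=> x; rewrite actM sinvM.
- exact: le_idem_domM.
- exact: idem_conjM.
Qed.

HB.instance Definition _ :=
  isMultiplicative.Build S (munn P) munn_rep munn_repM.

Lemma munn_rep_idem_sep : idempotent_separating munn_rep.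
Proof.
move=> e f ee ff ef.
pose e' := Idem (introT eqP ee); pose f' := Idem (introT eqP ff).
(* Equal images have second components with equal domains, and for an idempotent [s] that domain is
   the ideal below [s] itself. *)
have theta_dom s g : sl_le g (idem_dom s) <-> munn_theta (munn_rep s) g.
  exact: (prestrict_dom (Defs.down (idem_dom s)) (idem_conj s)).
have le_dom g : sl_le g e' <-> sl_le g f'.
  by rewrite -(idem_dom_val e') -(idem_dom_val f') !theta_dom ef.
have hef := (le_dom e').1 (sl_le_refl e').
have hfe := (le_dom f').2 (sl_le_refl f').
by rewrite -[e]/(val e') -[f]/(val f') hef mulsC -hfe.
Qed.

Lemma munn_rep_wide : wide (range munn_rep).
Proof.
move=> a aa; have [e [f [ha ht _]]] := munnP a.
(* The witness [e] is the idempotent at which the domain of [a] is principal; both components of [a]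
   are identities there, as are acting and conjugating by [e]. *)
exists (val e) => //; apply: munn_eq.
  have aaa := congr1 (@munn_alpha _ _ _) aa.
  rewrite (idem_pinjective (@munn_alpha_inj _ _ _ a) aaa (oiso_dom ha)).
  rewrite /= /munn_rep_alpha idem_dom_val.
  apply: eq_prestrict => x /principal_restrictE xe.
  by rewrite sinv_idem ?idemP // act_le_supp.
have aat := congr1 (@munn_theta _ _ _) aa.
rewrite (idem_pinjective (@munn_theta_inj _ _ _ a) aat (oiso_dom ht)).
rewrite /= /munn_rep_theta idem_dom_val.
by apply: eq_prestrict => x xe; rewrite idem_conj_val -xe.
Qed.
End MunnRepresentation.

Theorem theoremC (S : invSemigroupType) (X : Type) (A : supportedAction X S) :
  exists xi : {multiplicative S -> munn (restrict_idem A)},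
    [/\ idempotent_separating xi,
        inverse_subsemigroup (range xi) &
        wide (range xi)].
Proof.
exists (munn_rep A); split.
- exact: munn_rep_idem_sep.
- split=> [_ _ [s _ <-] [t _ <-]|_ [s _ <-]].
    by exists (s * t) => //; apply: munn_repM.
  (* The image of [s^-1] satisfies the two equations for an inverse of the image of [s], hence is
     that inverse. *)
  exists (sinv s) => //; apply: sinv_uniq.
    by rewrite -!munn_repM mulsVs.
  by rewrite -!munn_repM mulVsV.
- exact: munn_rep_wide.
Qed.
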